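(* Let $q$ be an odd prime power and let $k$ be an integer with $2\le k\le q-2$. Assume that the following holds for $q$ and $k$: for every polynomial $f\in\mathbb{F}_q[x]$ of degree at most $q-1$, the word $u_f$ is a deep hole of the Reed-Solomon code $RS(q,k)$ if and only if $\deg(f)=k$. Then the covering radius of the projective Reed-Solomon code $PRS(q+1,k)$ is $q-k$, and for every polynomial $f\in\mathbb{F}_q[x]$ with $\deg(f)=k$ and every $v\in\mathbb{F}_q$, the word $(u_f,v)\in\mathbb{F}_q^{q+1}$ is a deep hole of $PRS(q+1,k)$.
   Context: Write $\mathbb{F}_q=\{\alpha_1,\dots,\alpha_q\}$. For a polynomial $f\in\mathbb{F}_q[x]$ of degree at most $q-1$, put $u_f=(f(\alpha_1),\dots,f(\alpha_q))\in\mathbb{F}_q^q$; for $v\in\mathbb{F}_q$, $(u_f,v)\in\mathbb{F}_q^{q+1}$ is $u_f$ with $v$ appended as last coordinate. The Reed-Solomon code is $RS(q,k)=\{u_f: f\in\mathbb{F}_q[x],\ \deg f\le k-1\}\subseteq\mathbb{F}_q^q$. The projective Reed-Solomon code is $PRS(q+1,k)=\{(u_f,c_{k-1}(f)) : f\in\mathbb{F}_q[x],\ \deg f\le k-1\}\subseteq \mathbb{F}_q^{q+1}$, where $c_{k-1}(f)$ is the coefficient of $x^{k-1}$ in $f$. For a linear code $C\subseteq\mathbb{F}_q^n$ and $u\in\mathbb{F}_q^n$, $d(u,C)$ is the minimum Hamming distance from $u$ to a codeword of $C$; the covering radius is $\rho(C)=\max\{d(u,C): u\in\mathbb{F}_q^n\}$;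 a word $u$ is a deep hole of $C$ if $d(u,C)=\rho(C)$. *)

(* Defs.v *)
From mathcomp Require Import all_boot all_order all_algebra.

Set Implicit Arguments.
Unset Strict Implicit.
Unset Printing Implicit Defensive.

Import GRing.Theory.
Local Open Scope ring_scope.

Section Distance.

Variables (F : finFieldType) (n : nat).
Implicit Types (u v : 'rV[F]_n) (C : {set 'rV[F]_n}).

Definition hamming u v : nat := #|[set i | u 0 i != v 0 i]|.

(* Since [hamming u c <= n] always holds, the default value [n] does not affect
   the minimum when [C] is nonempty, as linear codes are. *)
Definition code_dist u C : nat := \big[minn/n]_(c in C) hamming u c.

Definition covering_radius C : nat := (\max_u code_dist u C)%N.

Definition deep_hole C u : Prop := code_dist u C = covering_radius C.

End Distance.

Section ReedSolomon.

Variables (F : finFieldType) (q : nat) (alpha : 'I_q -> F).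

Definition eval_word (f : {poly F}) : 'rV[F]_q := \row_i f.[alpha i].

Definition append (u : 'rV[F]_q) (v : F) : 'rV[F]_(q + 1) :=
  row_mx u (const_mx v).

(* [{poly_k F}] is the finite type of polynomials with [size f <= k], that is,
   of degree at most [k - 1], zero included. *)
Definition RS (k : nat) : {set 'rV[F]_q} :=
  [set eval_word f | f : {poly_k F}].

Definition PRS (k : nat) : {set 'rV[F]_(q + 1)} :=
  [set append (eval_word f) (f : {poly F})`_k.-1 | f : {poly_k F}].

End ReedSolomon.

(* Main.v *)
From mathcomp Require Import all_boot all_order all_algebra all_field.
Require Import Defs.

(** A degree-[k] polynomial meets any polynomial of degree below [k] in at most
    [k] points, so [(u_f, v)] is at distance at least [q - k] from PRS.
    Conversely, subtract from [f] a multiple of [\prod_(x in T) ('X - x%:P)],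
    with [#|T| = k], that cancels the leading term: the result agrees with [f]
    on [T], and its coefficient of index [k - 1] can be prescribed because, [q]
    being odd, every element of the field is a sum of [k] distinct elements.
    For [deg f <> k], the assumption puts [u_f] within [q - k - 1] of RS, and
    the extra coordinate costs at most one. *)

Set Implicit Arguments.
Unset Strict Implicit.
Unset Printing Implicit Defensive.

Import GRing.Theory.
Local Open Scope ring_scope.

(** * Hamming distance and distance to a code *)

Lemma code_dist_le (F : finFieldType) n (C : {set 'rV[F]_n}) u c :
  c \in C -> (code_dist u C <= hamming u c)%N.
Proof.
move=> Cc; rewrite /code_dist; have := mem_index_enum c.
elim: (index_enum _) => //= a s IHs; rewrite inE big_cons => /orP[/eqP<-|/IHs].
  by rewrite Cc geq_minl.
by case: ifP => // _; apply: leq_trans; apply: geq_minr.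
Qed.

Lemma le_code_dist (F : finFieldType) n (C : {set 'rV[F]_n}) u m :
  (m <= n)%N -> (forall c, c \in C -> m <= hamming u c)%N ->
  (m <= code_dist u C)%N.
Proof.
move=> le_mn leC; rewrite /code_dist; elim/big_ind: _ => // x y.
by rewrite leq_min => -> ->.
Qed.

(** The strict bound excludes the default value [n] of the minimum, so the value comes from a
    codeword. *)
Lemma code_dist_attained (F : finFieldType) n (C : {set 'rV[F]_n}) u :
  (code_dist u C < n)%N -> exists2 c, c \in C & hamming u c = code_dist u C.
Proof.
rewrite /code_dist.
elim/big_rec: _ => [|c d Cc IHd]; first by rewrite ltnn.
case: (leqP (hamming u c) d) => [_ _|_ /IHd//].
by exists c.
Qed.

Lemma hammingE (F : finFieldType) n (u v : 'rV[F]_n) :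
  hamming u v = (\sum_i (u 0%R i != v 0%R i))%N.
Proof.
rewrite /hamming -sum1_card big_mkcond; apply: eq_bigr => i _.
by rewrite inE; case: eqP.
Qed.

Lemma hamming_append (F : finFieldType) q (u c : 'rV[F]_q) (v w : F) :
  hamming (append u v) (append c w) = (hamming u c + (v != w))%N.
Proof.
rewrite !hammingE big_split_ord /= big_ord1; congr (_ + _)%N.
  by apply: eq_bigr => i _; rewrite !row_mxEl.
by rewrite !row_mxEr !mxE.
Qed.

(** * Evaluation words *)

Section Evaluation.

Variables (q : nat) (F : finFieldType) (alpha : 'I_q -> F).

(** The two words agree exactly at the indices of roots of [f - g], and a nonzero polynomial has
    fewer roots than its size. *)
Lemma hamming_eval_word (f g : {poly F}) :
  injective alpha -> f != g ->
  (q < hamming (eval_word alpha f) (eval_word alpha g) + size (f - g)%R)%N.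
Proof.
move=> alpha_inj neq_fg; set A := [set i | root (f - g) (alpha i)].
have -> : hamming (eval_word alpha f) (eval_word alpha g) = (q - #|A|)%N.
  rewrite /hamming cardsCs card_ord; congr (_ - _)%N; apply: eq_card => i.
  by rewrite !inE !mxE negbK rootE !hornerE subr_eq0.
have: (size [seq alpha i | i in A] < size (f - g)%R)%N.
  apply: max_poly_roots; first by rewrite subr_eq0.
    by apply/allP=> _ /imageP[i Ai ->]; rewrite inE in Ai.
  by rewrite map_inj_uniq ?enum_uniq.
rewrite size_image -(leq_add2l (q - #|A|)) addnS subnK //.
by rewrite -[X in (_ <= X)%N](card_ord q) max_card.
Qed.

(** Evaluation, read on coefficient vectors of length [q], is an injective self-map of a finite set,
    hence bijective. *)
Lemma eval_word_surj (u : 'rV[F]_q) : injective alpha ->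
  exists2 f : {poly F}, (size f <= q)%N & u = eval_word alpha f.
Proof.
move=> alpha_inj.
have eval_inj : injective (fun w : 'rV[F]_q => eval_word alpha (rVpoly w)).
  move=> w1 w2 eq_w; apply/(can_inj rVpolyK)/eqP; apply/negPn/negP => neq_w.
  have := hamming_eval_word alpha_inj neq_w.
  rewrite eq_w /hamming.
  set H := [set i | _]; have -> : H = set0.
    by apply/setP=> i; rewrite !inE eqxx.
  by rewrite cards0 -linearB ltnNge size_poly.
have [g _ gK] := injF_bij eval_inj.
by exists (rVpoly (g u)); rewrite ?size_poly ?gK.
Qed.

Lemma mem_PRS k (g : {poly F}) : (size g <= k)%N ->
  append (eval_word alpha g) g`_k.-1 \in PRS alpha k.
Proof. by move=> sz_g; apply/imsetP; exists (NPoly sz_g). Qed.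

Lemma mem_RS k (g : {poly F}) : (size g <= k)%N ->
  eval_word alpha g \in RS alpha k.
Proof. by move=> sz_g; apply/imsetP; exists (NPoly sz_g). Qed.

End Evaluation.

(** * Sums of [k] distinct field elements *)

Section SubsetSums.

Variable F : finFieldType.

(** In characteristic 2 the field has a power of 2 elements, which is odd only for the trivial power
    1. *)
Lemma two_neq0 : odd #|F| -> 2%:R != 0 :> F.
Proof.
move=> oddF; apply/negP=> /eqP two0.
have char2 : 2 \in [pchar F] by rewrite inE two0 eqxx.
have cardF : #|F| = (2 ^ logn 2 #|F|)%N := card_pprimeChar char2.
have := finNzRing_gt1 F; move: oddF; rewrite cardF oddX orbF => /eqP->.
by rewrite expn0 ltnn.
Qed.

(** The set grows by pairs [x], [- x], which are distinct because [2] is nonzero. *)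
Lemma symmetric_subset m : odd #|F| -> (m.*2 < #|F|)%N ->
  exists T : {set F},
    [/\ #|T| = m.*2, 0 \notin T & {in T, forall x, - x \in T}].
Proof.
move=> oddF; elim: m => [_|m IHm lt_m].
  by exists set0; split=> [||x]; rewrite ?cards0 ?inE.
have [|T [cardT T0 TN]] := IHm.
  by apply: ltn_trans lt_m; rewrite ltn_double.
have /subsetPn[x _] : ~~ ([set: F] \subset 0 |: T).
  apply/negP=> /subset_leq_card; rewrite cardsT cardsU1 T0 cardT leqNgt.
  by rewrite (leq_trans _ lt_m) // doubleS add1n.
rewrite !inE negb_or => /andP[x0 xT].
have NxT : - x \notin T by apply: contra xT => /TN; rewrite opprK.
have xNx : x != - x.
  by rewrite -addr_eq0 -mulr2n -mulr_natl mulf_neq0 ?two_neq0.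
exists (x |: (- x |: T)); split.
- by rewrite !cardsU1 !inE negb_or xNx xT NxT cardT.
- by rewrite !inE !negb_or ![0 == _]eq_sym oppr_eq0 x0.
- move=> y; rewrite !inE => /or3P[/eqP->|/eqP->|/TN->]; last by rewrite !orbT.
    by rewrite eqxx orbT.
  by rewrite opprK eqxx.
Qed.

(** A symmetric set sums to zero; when [k] is odd, the element 0 is added to reach the right
    size. *)
Lemma zero_subset_sum k : odd #|F| -> (k <= #|F|)%N ->
  exists2 T : {set F}, #|T| = k & \sum_(x in T) x = 0.
Proof.
move=> oddF le_k.
have lt_k : (k./2.*2 < #|F|)%N.
  rewrite ltn_neqAle (leq_trans _ le_k) ?andbT.
    by apply: contraTneq oddF => <-; rewrite odd_double.
  by rewrite -[leqRHS](odd_double_half k) leq_addl.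
have [T [cardT T0 TN]] := symmetric_subset oddF lt_k.
have sumT : \sum_(x in T) x = 0.
  apply/eqP; suff: 2%:R * (\sum_(x in T) x) == 0.
    by rewrite mulf_eq0 (negPf (two_neq0 oddF)).
  (* Reindexing one of the two copies of the sum by [x -> - x] makes it cancel the other. *)
  rewrite mulr_natl mulr2n {1}(reindex_inj oppr_inj) /= sumrN addrC subr_eq0.
  apply/eqP/eq_bigl => x; apply/idP/idP => /TN //; by rewrite opprK.
case k_odd: (odd k); last first.
  by exists T; rewrite // cardT -[RHS](odd_double_half k) k_odd.
exists (0 |: T); last by rewrite big_setU1 //= sumT addr0.
by rewrite cardsU1 T0 cardT -[RHS](odd_double_half k) k_odd.
Qed.

(** If some [k]-subset sums to zero, exchanging one element [x] for an outside element [y] changes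
    the sum to [y - x]. *)
Lemma nonzero_subset_sum k : (0 < k < #|F|)%N ->
  exists2 T : {set F}, #|T| = k & \sum_(x in T) x != 0.
Proof.
case/andP=> k_gt0 lt_k.
pose T := [set x in take k (enum F)].
have cardT : #|T| = k.
  rewrite cardsE; have /card_uniqP-> := take_uniq k (enum_uniq F).
  by rewrite size_take -cardE lt_k.
have [sumT|sumT] := eqVneq (\sum_(x in T) x) 0; last by exists T.
have [x Tx] : exists x, x \in T by apply/card_gt0P; rewrite cardT.
have /subsetPn[y _ Ty] : ~~ ([set: F] \subset T).
  by apply/negP=> /subset_leq_card; rewrite cardsT cardT leqNgt lt_k.
have yTx : y \notin T :\ x by rewrite in_setD1 (negPf Ty) andbF.
exists (y |: (T :\ x)).
  by rewrite cardsU1 yTx; move: cardT; rewrite (cardsD1 x T) Tx.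
rewrite big_setU1 //=; move: sumT; rewrite (big_setD1 x) //= addrC.
move=> /eqP; rewrite addr_eq0 => /eqP->; rewrite subr_eq0.
by apply: contraNneq Ty => ->.
Qed.

(** Scaling a subset by a nonzero factor keeps its size, so one nonzero sum yields all of them. *)
Lemma subset_sum k s : odd #|F| -> (0 < k < #|F|)%N ->
  exists2 T : {set F}, #|T| = k & \sum_(x in T) x = s.
Proof.
move=> oddF lt_k.
have [->|s0] := eqVneq s 0.
  by apply: zero_subset_sum => //; case/andP: lt_k => _ /ltnW.
have [T cardT sumT] := nonzero_subset_sum lt_k.
set t := \sum_(x in T) x in sumT.
have st0 : s / t != 0 by rewrite mulf_neq0 ?invr_eq0.
exists [set s / t * x | x in T]; first by rewrite card_imset //; apply: mulfI.
rewrite big_imset /=; last by move=> x y _ _; apply: mulfI.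
by rewrite -mulr_sumr divfK.
Qed.

End SubsetSums.

(** * Distances to the projective code *)

Section CoveringRadius.

Variables (q k : nat) (F : finFieldType) (alpha : 'I_q -> F).
Hypothesis alpha_bij : bijective alpha.

Lemma code_dist_PRS_ge (f : {poly F}) (v : F) : size f = k.+1 ->
  (q - k <= code_dist (append (eval_word alpha f) v) (PRS alpha k))%N.
Proof.
move=> sz_f; apply: le_code_dist => [|c /imsetP[g _ ->]].
  by rewrite (leq_trans (leq_subr _ _)) ?leq_addr.
have sz_g := size_npoly g.
have neq_fg : f != g.
  by apply: contraTneq sz_g => <-; rewrite sz_f ltnn.
have szB : size (f - g) = k.+1.
  by rewrite size_polyDl ?size_polyN sz_f ?ltnS.
have := hamming_eval_word (bij_inj alpha_bij) neq_fg.
rewrite szB addnS ltnS hamming_append leq_subLR [(k + _)%N]addnC => le_q.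
by rewrite (leq_trans le_q) ?leq_add2r ?leq_addr.
Qed.

Lemma closest_PRS_codeword (f : {poly F}) (v : F) :
  odd #|F| -> (0 < k < #|F|)%N -> size f = k.+1 ->
  exists g : {poly F}, [/\ (size g <= k)%N, g`_k.-1 = v &
    hamming (eval_word alpha f) (eval_word alpha g) = (q - k)%N].
Proof.
move=> oddF lt_k sz_f; set a := lead_coef f.
have a0 : a != 0 by rewrite lead_coef_eq0 -size_poly_gt0 sz_f.
(* The coefficient of index [k - 1] in [p] below is minus the sum over [T], so this target makes
   that of [f - a *: p] equal to [v]. *)
have [T cardT sumT] := subset_sum ((v - f`_k.-1) / a) oddF lt_k.
pose p := \prod_(x <- enum T) ('X - x%:P).
have sz_p : size p = k.+1 by rewrite size_prod_XsubC -cardE cardT.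
have p_monic : p \is monic by apply: monic_prod_XsubC.
exists (f - a *: p); split.
- apply/leq_sizeP => j; rewrite leq_eqVlt coefB coefZ => /predU1P[<-|lt_kj].
    have := monicP p_monic; rewrite /lead_coef sz_p /= => ->.
    by rewrite mulr1 /a lead_coefE sz_f subrr.
  by rewrite !nth_default ?sz_f ?sz_p // mulr0 subrr.
- have szT : size (enum T) = k by rewrite -cardE.
  have := @coefPn_prod_XsubC _ (enum T); rewrite szT -/p -lt0n.
  case/andP: lt_k => k_gt0 _ /(_ k_gt0).
  rewrite big_enum /= sumT coefB coefZ => ->.
  by rewrite mulrN opprK mulrC divfK // addrC subrK.
(* The difference of the two polynomials is [a *: p], so the words agree exactly on the preimage of
   [T] under [alpha], which has [k] elements. *)
- rewrite /hamming cardsCs card_ord -cardT; congr (_ - _)%N.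
  rewrite -(@on_card_preimset _ _ alpha); last exact: onW_bij.
  apply: eq_card => i; rewrite !inE !mxE negbK !hornerE.
  rewrite -subr_eq0 opprB addrC subrK mulf_eq0 (negPf a0) /=.
  by rewrite -[_ == 0]/(root p _) root_prod_XsubC mem_enum.
Qed.

Lemma code_dist_RS_le (f : {poly F}) :
  odd #|F| -> (0 < k < #|F|)%N -> size f = k.+1 ->
  (code_dist (eval_word alpha f) (RS alpha k) <= q - k)%N.
Proof.
move=> oddF lt_k sz_f.
(* The prescribed coefficient 0 is arbitrary: RS ignores it. *)
have [g [sz_g _ <-]] := closest_PRS_codeword 0 oddF lt_k sz_f.
by rewrite code_dist_le ?mem_RS.
Qed.

Lemma code_dist_PRS (f : {poly F}) (v : F) :
  odd #|F| -> (0 < k < #|F|)%N -> size f = k.+1 ->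
  code_dist (append (eval_word alpha f) v) (PRS alpha k) = (q - k)%N.
Proof.
move=> oddF lt_k sz_f; apply/eqP; rewrite eqn_leq code_dist_PRS_ge // andbT.
have [g [sz_g gv hfg]] := closest_PRS_codeword v oddF lt_k sz_f.
apply: leq_trans (code_dist_le _ (mem_PRS alpha sz_g)) _.
by rewrite hamming_append gv eqxx addn0 hfg.
Qed.

Lemma code_dist_PRS_le_RS (u : 'rV[F]_q) (v : F) :
  (code_dist u (RS alpha k) < q)%N ->
  (code_dist (append u v) (PRS alpha k) <= (code_dist u (RS alpha k)).+1)%N.
Proof.
move=> /code_dist_attained[_ /imsetP[g _ ->] <-].
apply: leq_trans (code_dist_le _ (mem_PRS alpha (size_npoly g))) _.
by rewrite hamming_append -addn1 leq_add2l leq_b1.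
Qed.

End CoveringRadius.

Theorem theoremI6 (q k : nat) (F : finFieldType) (card_F : #|F| = q)
    (odd_q : odd q) (k_ge2 : (2 <= k)%N) (k_le : (k <= q - 2)%N)
    (alpha : 'I_q -> F) (alpha_bij : bijective alpha)
    (RS_deep_holes : forall f : {poly F}, (size f <= q)%N ->
       (deep_hole (RS alpha k) (eval_word alpha f) <-> size f = k.+1)) :
  covering_radius (PRS alpha k) = (q - k)%N /\
  (forall (f : {poly F}) (v : F), size f = k.+1 ->
     deep_hole (PRS alpha k) (append (eval_word alpha f) v)).
Proof.
have oddF : odd #|F| by rewrite card_F.
(* Subtraction is truncated, so [q - 2 < q] uses that the odd number [q] is positive. *)
have lt_kq : (k < q)%N.
  by rewrite (leq_ltn_trans k_le) // ltn_subrL /= odd_gt0.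
have lt_k : (0 < k < #|F|)%N by rewrite card_F lt_kq ltnW.
have radius_RS : (covering_radius (RS alpha k) <= q - k)%N.
  (* The word of ['X^k] is a deep hole of RS by assumption, so its distance is the covering
     radius. *)
  have szX : size ('X^k : {poly F}) = k.+1 by rewrite size_polyXn.
  have le_szX : (size ('X^k : {poly F}) <= q)%N by rewrite szX.
  by have [_ /(_ szX) <-] := RS_deep_holes _ le_szX; apply: code_dist_RS_le.
have radius_PRS : covering_radius (PRS alpha k) = (q - k)%N.
  apply/eqP; rewrite eqn_leq; apply/andP; split; last first.
    rewrite -(code_dist_PRS alpha_bij 0 oddF lt_k (size_polyXn _ k)).
    exact: leq_bigmax.
  apply/bigmax_leqP => w _.
  have [f sz_f fE] := eval_word_surj (lsubmx w) (bij_inj alpha_bij).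
  have -> : w = append (eval_word alpha f) (w 0 (rshift q 0)).
    rewrite -fE -[LHS]hsubmxK; congr row_mx.
    by apply/matrixP=> i j; rewrite !mxE !ord1.
  have [sz_fk|sz_fk] := eqVneq (size f) k.+1; first by rewrite code_dist_PRS.
  (* Not being a deep hole, the word of [f] lies strictly below the radius; this spare unit pays for
     the last coordinate. *)
  have lt_d : (code_dist (eval_word alpha f) (RS alpha k) < q - k)%N.
    apply: leq_trans radius_RS; rewrite ltn_neqAle.
    rewrite [X in _ && X]leq_bigmax andbT.
    by apply: contra_neq sz_fk => /(RS_deep_holes f sz_f).
  apply: (leq_trans _ lt_d); apply: code_dist_PRS_le_RS.
  by rewrite (leq_trans lt_d) ?leq_subr.
by split=> // f v sz_f; rewrite /deep_hole radius_PRS code_dist_PRS.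
Qed.
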